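(* Let $\mathcal{H}$ be a directed acyclic hypergraph (Bayesian hypergraph structure) on a finite vertex set $V$ and let $A\subseteq V$ be a set of variables set by intervention, $x_a=a_0$ for $a\in A$. Let $\hat{\mathcal{H}}_A$ be the DAH obtained from $\mathcal{H}$ by replacing each hyperedge $h$ with $S=H(h)\cap A\neq\emptyset$ by the hyperedge $(T(h)\cup S,\,H(h)\setminus S)$, and then removing all hyperedges with empty head. Then $\mathcal{H}$ and $\hat{\mathcal{H}}_A$ admit the same factorization decomposition.
   Context: Directed hypergraph on $V$: hyperedges $h=(T(h),H(h))$ with disjoint, possibly empty $T(h),H(h)\subseteq V$; $u$ parent of $v$ if $u\in T(h),v\in H(h)$ for some $h$; $u,v$ co-head if $\{u,v\}\subseteq H(h)$ for some $h$. DAH: no partially directed cycle (cyclic sequence $v_1,\dots,v_k,v_1$ with each $v_i$ co-head with or parent of $v_{i+1}$, at least one parent step). Chain components: classes of the transitive-reflexive closure of co-head. $pa(\tau)=\bigcup_{v\in\tau}pa(v)\setminus\tau$; $\mathcal{H}_S$: hyperedges with $T(h)\cup H(h)\subseteq S$; $\mathcal{M}(\mathcal{F})$: inclusion-maximal sets among $\{T(h)\cup H(h):h\in\mathcal{F}\}$. Factorization with intervention: a density $f$ on $\times_{v\in V}\mathcal{X}_v$ (w.r.t. product measure $\mu$) factorizes according to a DAH $\mathcal{K}$ with $A$ intervened if configurations with $x_a\ne a_0$ for some $a\in A$ have probability zero and $f(x\|x_A)=\prod_\tau f(x_{\tau\setminus A}\mid x_{pa(\tau)},x_{\tau\cap A})$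 over chain components $\tau$ of $\mathcal{K}$, where, with $\mathcal{K}^*_\tau$ the hyperedges $h$ of $\mathcal{K}_{\tau\cup pa(\tau)}$ with $H(h)\subseteq\tau$, $f(x_{\tau\setminus A}\mid x_{pa(\tau)},x_{\tau\cap A})=Z^{-1}(x_{pa(\tau)},x_{\tau\cap A})\prod_{h\in\mathcal{M}(\mathcal{K}^*_\tau)}\psi_h(x)$, $\psi_h\ge0$ depending only on $x_h$, $Z=\int_{\mathcal{X}_{\tau\setminus A}}\prod_h\psi_h\,d\mu_{\tau\setminus A}$. Two DAHs admit the same factorization decomposition if every density factorizing according to one (with $A$ intervened) factorizes according to the other, and vice versa.
   Formalization: Every hyperedge of H is assumed to have nonempty head; with empty heads allowed the claim fails (V={1}, one hyperedge ({1},∅), A=∅). The product formula is read almost everywhere on the slice x_A=a_0, with a factor taken as 0 where Z is 0 or infinite. *)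

(* Defs.v *)
From HB Require Import structures.
From mathcomp Require Import all_boot all_order all_algebra.
From mathcomp Require Import all_classical all_reals all_analysis.

Set Implicit Arguments.
Unset Strict Implicit.
Unset Printing Implicit Defensive.

Import Order.TTheory GRing.Theory Num.Theory.
Import numFieldNormedType.Exports.

Section Hypergraphs.
Variable V : finType.

(* A hyperedge is the pair (tail, head); either component may be empty. *)
Definition hyperedge := ({set V} * {set V})%type.
Definition htail (h : hyperedge) : {set V} := h.1.
Definition hhead (h : hyperedge) : {set V} := h.2.
Definition vset (h : hyperedge) : {set V} := htail h :|: hhead h.

Implicit Types (E : {set hyperedge}) (A S tau : {set V}).

Definition parent E (u v : V) : bool :=
  [exists h in E, (u \in htail h) && (v \in hhead h)].

Definition cohead E (u v : V) : bool :=
  [exists h in E, (u \in hhead h) && (v \in hhead h)].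

(* [ordS i] is the cyclic successor of [i] in ['I_k]. *)
Definition pd_cycle E (k : nat) (v : 'I_k -> V) : Prop :=
  (forall i, cohead E (v i) (v (ordS i)) \/ parent E (v i) (v (ordS i))) /\
  (exists i, parent E (v i) (v (ordS i))).

Record dah := DAH {
  hedges :> {set hyperedge};
  hedges_disjoint : forall h, h \in hedges -> [disjoint htail h & hhead h];
  hedges_acyclic : forall (k : nat) (v : 'I_k -> V), ~ pd_cycle hedges v
}.

Definition chain_components E : {set {set V}} :=
  equivalence_partition (connect (cohead E)) [set: V].

Definition parents E (v : V) : {set V} := finset (fun u => parent E u v).

Definition pa E tau : {set V} := (\bigcup_(v in tau) parents E v) :\: tau.

Definition induced E S : {set hyperedge} :=
  finset (fun h => (h \in E) && (vset h \subset S)).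

Definition comp_edges E tau : {set hyperedge} :=
  finset (fun h => (h \in induced E (tau :|: pa E tau)) && (hhead h \subset tau)).

Definition maximal_vsets E : {set {set V}} :=
  finset (fun S => maxset (fun S' => S' \in vset @: E) S).

(* When [S] is empty the hyperedge is left unchanged. *)
Definition intervene_edge A (h : hyperedge) : hyperedge :=
  let S := hhead h :&: A in (htail h :|: S, hhead h :\: S).

Definition intervene_edges A E : {set hyperedge} :=
  finset (fun h => (h \in intervene_edge A @: E) && (hhead h != finset.set0)).

Lemma intervene_edgesP A E h : h \in intervene_edges A E ->
  exists2 h0, h0 \in E & h = intervene_edge A h0.
Proof. by rewrite inE => /andP[/imsetP[h0 h0E ->] _]; exists h0. Qed.

Lemma hhead_intervene A h : hhead (intervene_edge A h) = hhead h :\: A.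
Proof. by apply/setP => x; rewrite !inE; case: (x \in A); case: (x \in _). Qed.

Lemma cohead_intervene A E u v : cohead (intervene_edges A E) u v ->
  cohead E u v /\ v \notin A.
Proof.
case/existsP => h /andP[/intervene_edgesP[h0 h0E ->]].
rewrite hhead_intervene !inE => /andP[/andP[_ uh] /andP[vA vh]].
by split=> //; apply/existsP; exists h0; rewrite h0E uh.
Qed.

Lemma parent_intervene A E u v : parent (intervene_edges A E) u v ->
  (u \notin A -> parent E u v) /\ v \notin A.
Proof.
case/existsP => h /andP[/intervene_edgesP[h0 h0E ->]].
rewrite hhead_intervene !inE => /andP[uh /andP[vA vh]].
split=> // uA; apply/existsP; exists h0; rewrite h0E vh.
by move: uh; rewrite (negPf uA) andbF orbF => ->.
Qed.

Lemma intervene_disjoint (H : dah) A h :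
  h \in intervene_edges A H -> [disjoint htail h & hhead h].
Proof.
case/intervene_edgesP => h0 /hedges_disjoint dh ->.
rewrite hhead_intervene; apply/pred0P => x /=; rewrite !inE.
have := pred0P dh x; rewrite /=.
by case: (x \in htail h0); case: (x \in hhead h0); case: (x \in A).
Qed.

Lemma intervene_acyclic (H : dah) A (k : nat) (v : 'I_k -> V) :
  ~ pd_cycle (intervene_edges A H) v.
Proof.
case=> step [i0 i0p].
have vA i : v i \notin A.
  rewrite -(ord_predK i).
  by case: (step (ord_pred i)) => [/cohead_intervene|/parent_intervene] [].
apply: (@hedges_acyclic H k v); split.
  move=> i; case: (step i) => [/cohead_intervene[]|/parent_intervene[]]; first by left.
  by move=> /(_ (vA i)); right.
by exists i0; have [/(_ (vA i0))] := parent_intervene i0p.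
Qed.

Definition intervene (H : dah) A : dah :=
  DAH (@intervene_disjoint H A) (@intervene_acyclic H A).

End Hypergraphs.

Local Open Scope classical_set_scope.
Local Open Scope ring_scope.

Section Configurations.
Variables (V : finType) (d : V -> measure_display).
Variable X : forall v, measurableType (d v).

Definition cylinders : set (set (forall v, X v)) :=
  \bigcup_(v in [set: V])
    preimage_set_system [set: forall v, X v] (fun x => x v) measurable.

(* [forall v, X v] with the product sigma-algebra. *)
Definition config := g_sigma_algebraType cylinders.

Definition agree (S : {set V}) (x y : config) : Prop :=
  forall v, v \in S -> x v = y v.

Variables (R : realType) (mu : forall v, {sigma_finite_measure set (X v) -> \bar R}).

(* [integral_on S g x] is the integral of [g] over the coordinates in [S], with
   respect to the product of the [mu v] for [v] in [S], the other coordinates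
   being those of [x].  It is written as an iterated integral: all integrands
   below are measurable and nonnegative, so by Tonelli the value is the integral
   for the product measure and the order of integration is immaterial. *)
Definition integral_on (S : {set V}) (g : config -> \bar R) : config -> \bar R :=
  foldr (fun v (g' : config -> \bar R) (x : config) =>
    (\int[mu v]_y g' (eqtype.dfwith x y))%E) g (enum S).

Definition ae_on (S : {set V}) (x : config) (P : set config) : Prop :=
  integral_on S (fun y => (\1_(~` P) y)%:E) x = 0%E.

Section Factorization.
Variables (A : {set V}) (a0 : config).

(* The intervened coordinates are held at [a0] (only the values [a0 a] for [a]
   in [A] matter), i.e. they carry a unit point mass; if each [mu a] is a counting
   measure, this is the normalization of a density on the whole product that
   vanishes where [x a] differs from [a0 a]. *)
Definition density (f : config -> R) : Prop :=
  [/\ measurable_fun [set: config] f, forall x, 0 <= f x &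
      integral_on (~: A)%SET (EFin \o f) a0 = 1%E].

Definition potential (h : {set V}) (psi : config -> R) : Prop :=
  [/\ measurable_fun [set: config] psi, forall x, 0 <= psi x &
      forall x y, agree h x y -> psi x = psi y].

Variable K : dah V.

Definition psi_prod (psi : {set V} -> {set V} -> config -> R) (tau : {set V})
    (x : config) : R :=
  \prod_(h in maximal_vsets (comp_edges K tau)) psi tau h x.

Definition Znorm psi (tau : {set V}) : config -> \bar R :=
  integral_on (tau :\: A) (EFin \o psi_prod psi tau).

(* If [Znorm] is [0] or [+oo] there is no conditional density, and this is [0]. *)
Definition cond_factor psi (tau : {set V}) (x : config) : R :=
  (fine (Znorm psi tau x))^-1 * psi_prod psi tau x.

(* The product formula is an identity between densities, hence holds almost
   everywhere on the slice where [x] agrees with [a0] on [A]. *)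
Definition factorizes (f : config -> R) : Prop :=
  (forall (x : config) a, a \in A -> x a <> a0 a -> f x = 0) /\
  exists psi : {set V} -> {set V} -> config -> R,
    (forall tau h, tau \in chain_components K ->
       h \in maximal_vsets (comp_edges K tau) -> potential h (psi tau h)) /\
    ae_on (~: A)%SET a0
      [set x | f x = \prod_(tau in chain_components K) cond_factor psi tau x].

End Factorization.

Definition same_factorization (A : {set V}) (a0 : config) (K K' : dah V) : Prop :=
  forall f, density A a0 f -> (factorizes A a0 K f <-> factorizes A a0 K' f).

End Configurations.

(* Main.v *)
(** Intervening keeps the vertex set of every hyperedge and splits a chain
    component [tau] of [H] into components [tau'] (those of [tau :\: A], and the
    singletons of [A]).  The maximal vertex sets of [tau'] are exactly those of
    [tau] that meet [tau' :\: A]; the remaining maximal sets of [tau] do not meet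
    [tau :\: A], so their potentials come out of the normalizing integral, which
    by Tonelli is their product [c] times the product of the normalizing integrals
    of the [tau'].  Hence the factor of [tau] is the product of the factors of the
    [tau'] where [c] is nonzero, and it is [0] where [c = 0].

    From the intervened hypergraph back to [H] one chooses [c = 1].  In the other
    direction the product [F] for [H] is at most the product [F'] for the
    intervened hypergraph.  Integrating out a terminal chain component at a time
    shows that [F'] has integral at most [1]; since the density, which is almost
    everywhere equal to [F], has integral [1], [F = F'] almost everywhere. *)
Require Import Defs.
From mathcomp Require Import all_boot all_order all_algebra.
From mathcomp Require Import all_classical all_reals all_analysis.
From mathcomp Require Import measurable_realfun.
From mathcomp Require Import lra.
Set Implicit Arguments.
Unset Strict Implicit.
Unset Printing Implicit Defensive.
Import Order.TTheory GRing.Theory Num.Theory.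
Local Open Scope ring_scope.

(** * Iterated integrals *)

Lemma emeasurable_prod dT (T : measurableType dT) (R : realType)
    (I : finType) (P : pred I) (f : I -> T -> \bar R) :
  (forall i, P i -> measurable_fun setT (f i)) ->
  measurable_fun setT (fun x => \prod_(i | P i) f i x)%E.
Proof.
move=> mf; under eq_fun do rewrite big_mkcond.
elim: (index_enum I) => [|i s IH].
  under eq_fun do rewrite big_nil; exact: measurable_cst.
under eq_fun do rewrite big_cons.
by apply: emeasurable_funM => //; case: (boolP (P i)) => [/mf//|_]; exact: measurable_cst.
Qed.

Section IteratedIntegral.
Variables (V : finType) (d : V -> measure_display).
Variable X : forall v, measurableType (d v).
Variables (R : realType) (mu : forall v, {sigma_finite_measure set (X v) -> \bar R}).
Implicit Types (S T U : {set V}) (g h : config X -> \bar R) (s : seq V).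
Local Open Scope ereal_scope.

Lemma measurable_coord v : measurable_fun setT (fun x : config X => x v).
Proof.
move=> _ B mB; apply: sub_sigma_algebra.
by exists v => //; exists B.
Qed.

(** It suffices to check cylinders. The preimage of a cylinder over the replaced coordinate
    constrains only the second argument, that of any other cylinder only the first, so both are
    measurable rectangles. *)
Lemma measurable_dfwith v :
  measurable_fun setT
    (fun p : config X * X v => eqtype.dfwith p.1 p.2 : config X).
Proof.
have H := @measurability _ _ (config X * X v)%type (config X) setT
  (fun p => eqtype.dfwith p.1 p.2 : config X) (@cylinders V d X) erefl.
apply: H.
move=> _ [_ [w _ [B mB <-]] <-]; rewrite !setTI.
have [E|vw] := eqVneq v w.
  subst w.
  rewrite [X in measurable X](_ : _ = (setT `*` B)%classic); first exact: measurableX.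
  by apply/seteqP; split => -[x y] /=; rewrite eqtype.dfwith_in //; case.
rewrite [X in measurable X](_ : _ = (((fun x : config X => x w) @^-1` B) `*` setT)%classic).
  apply: measurableX => //.
  by rewrite -[X in measurable X]setTI; exact: measurable_coord.
by apply/seteqP; split => -[x y] /=; rewrite eqtype.dfwith_out //; case.
Qed.

Lemma measurable_fun_dfwith dT (T : measurableType dT) v
    (a : T -> config X) (b : T -> X v) :
  measurable_fun setT a -> measurable_fun setT b ->
  measurable_fun setT (fun t => eqtype.dfwith (a t) (b t) : config X).
Proof.
move=> ma mb.
exact: (measurableT_comp (measurable_dfwith (v := v)) (measurable_fun_pair ma mb)).
Qed.

Definition nonneg_measurable g :=
  measurable_fun setT g /\ forall x, 0 <= g x.

Definition integral_coord v g : config X -> \bar R :=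
  fun x => \int[mu v]_y g (eqtype.dfwith x y).

(** Arbitrary lists replace the fixed enumeration of [integral_on], so that one can induct on the
    list and permute it. *)
Definition iterated s g : config X -> \bar R := foldr integral_coord g s.

Lemma nonneg_measurable_slice v g x : nonneg_measurable g ->
  measurable_fun setT (fun y : X v => g (eqtype.dfwith x y)).
Proof.
move=> [mg _]; apply: (measurableT_comp mg).
by apply: measurable_fun_dfwith.
Qed.

Lemma nonneg_measurable_integral_coord v g :
  nonneg_measurable g -> nonneg_measurable (integral_coord v g).
Proof.
move=> [mg g0]; split; last by move=> x; apply: integral_ge0.
apply: (@measurable_fun_fubini_tonelli_F _ _ (config X) (X v) R (mu v)
  (fun p => g (eqtype.dfwith p.1 p.2))) => // xy.
exact: (measurableT_comp mg (measurable_dfwith (v := v))).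
Qed.

Lemma nonneg_measurable_iterated s g :
  nonneg_measurable g -> nonneg_measurable (iterated s g).
Proof. by move=> ?; elim: s => //= v s IH; exact: nonneg_measurable_integral_coord. Qed.

Lemma dfwithC u v (x : config X) (y : X u) (z : X v) : u != v ->
  eqtype.dfwith (eqtype.dfwith x y) z = eqtype.dfwith (eqtype.dfwith x z) y.
Proof.
move=> uv; apply: functional_extensionality_dep => w.
have [E|vw] := eqVneq v w.
  by subst w; rewrite eqtype.dfwith_in eqtype.dfwith_out // eqtype.dfwith_in.
rewrite eqtype.dfwith_out //.
have [E|uw] := eqVneq u w; first by subst w; rewrite !eqtype.dfwith_in.
by rewrite !eqtype.dfwith_out.
Qed.

(** This is Tonelli: updates at distinct coordinates commute. *)
Lemma integral_coordC u v g : nonneg_measurable g ->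
  integral_coord u (integral_coord v g) = integral_coord v (integral_coord u g).
Proof.
move=> [mg g0]; have [->//|uv] := eqVneq u v.
apply/funext => x; rewrite /integral_coord.
rewrite (fubini_tonelli (m1 := mu u) (m2 := mu v)
  (fun p => g (eqtype.dfwith (eqtype.dfwith x p.1) p.2))) //=.
  by apply: eq_integral => z _; apply: eq_integral => y _; rewrite dfwithC.
apply: (measurableT_comp mg); apply: measurable_fun_dfwith => //.
exact: measurable_fun_dfwith.
Qed.

(** The head of [s] occurs somewhere in [t]; adjacent exchanges bring it to the front, and induction
    treats the tails. *)
Lemma iterated_perm s t g : nonneg_measurable g -> perm_eq s t ->
  iterated s g = iterated t g.
Proof.
move=> gg; elim: s t => [|v s IH] t; first by rewrite perm_sym => /perm_nilP ->.
move=> st; have vt : v \in t by rewrite -(perm_mem st) mem_head.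
case/splitPr: vt st => t1 t2; rewrite -[v :: t2]cat1s.
rewrite perm_sym perm_catCA /= perm_cons perm_sym => st.
rewrite (IH _ st) {IH st s}; elim: t1 => //= u t1 <-; rewrite integral_coordC //.
exact: nonneg_measurable_iterated.
Qed.

Lemma integral_onE S g : integral_on mu S g = iterated (enum S) g.
Proof. by []. Qed.

Lemma nonneg_measurable_integral_on S g :
  nonneg_measurable g -> nonneg_measurable (integral_on mu S g).
Proof. exact: nonneg_measurable_iterated. Qed.

Lemma integral_on0 g : integral_on mu finset.set0 g = g.
Proof. by rewrite /integral_on enum_set0. Qed.

Lemma integral_on_setU S T g : nonneg_measurable g -> [disjoint S & T] ->
  integral_on mu (S :|: T) g = integral_on mu S (integral_on mu T g).
Proof.
move=> gg dST; rewrite !integral_onE.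
rewrite (@iterated_perm _ (enum S ++ enum T)) //; first by rewrite /iterated foldr_cat.
apply: uniq_perm; rewrite ?cat_uniq ?enum_uniq //=; last first.
  by move=> v; rewrite mem_cat !mem_enum inE.
rewrite andbT; apply/hasPn => v /=; rewrite !mem_enum => vT.
by apply/negP => vS; have /pred0P/(_ v)/= := dST; rewrite vS vT.
Qed.

(** The codomain is left free to cover both real and extended real functions. *)
Definition depends_on Y (U : {set V}) (g : config X -> Y) :=
  forall x y, agree U x y -> g x = g y.

Lemma depends_on_sub Y U T (g : config X -> Y) :
  U \subset T -> depends_on U g -> depends_on T g.
Proof. by move=> /fintype.subsetP UT dg x y xy; apply: dg => v /UT /xy. Qed.

Lemma iterated_agree s g x y U : depends_on U g ->
  (forall v, v \in U -> v \notin s -> x v = y v) -> iterated s g x = iterated s g y.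
Proof.
move=> dg; elim: s x y => [|v s IH] x y xy /=.
  by apply: dg => v vU; exact: xy.
apply: eq_integral => z _; apply: IH => w wU ws.
have [E|vw] := eqVneq v w; first by subst w; rewrite !eqtype.dfwith_in.
by rewrite !eqtype.dfwith_out // xy // inE negb_or ws eq_sym vw.
Qed.

Lemma depends_on_integral_on S U g : depends_on U g ->
  depends_on (U :\: S) (integral_on mu S g).
Proof.
move=> dg x y xy; apply: (iterated_agree dg) => v vU.
by rewrite mem_enum => vS; apply: xy; rewrite inE vS.
Qed.

Lemma iteratedZl s c g x : nonneg_measurable g -> (forall x, 0 <= c x) ->
  (forall y z, agree (finset (fun v => v \notin s)) y z -> c y = c z) ->
  iterated s (fun y => c y * g y) x = c x * iterated s g x.
Proof.
move=> gg c0; elim: s x => //= v s IH x dc.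
rewrite /integral_coord.
rewrite -ge0_integralZl //.
- apply: eq_integral => y _; rewrite IH; first congr (_ * _).
    apply: dc => w; rewrite !inE negb_or => /andP[wv _].
    by rewrite eqtype.dfwith_out // eq_sym.
  by move=> z t zt; apply: dc => w; rewrite !inE negb_or => /andP[_ ws]; apply: zt; rewrite inE.
- exact/nonneg_measurable_slice/nonneg_measurable_iterated.
- by move=> y _; case: (nonneg_measurable_iterated s gg).
Qed.

Lemma integral_onZl S c g x : nonneg_measurable g -> (forall x, 0 <= c x) ->
  depends_on (~: S) c ->
  integral_on mu S (fun y => c y * g y) x = c x * integral_on mu S g x.
Proof.
move=> gg c0 dc; rewrite integral_onE iteratedZl // => y z yz; apply: dc => v.
by rewrite inE => vS; apply: yz; rewrite inE mem_enum.
Qed.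

Lemma integral_onD S g h x : nonneg_measurable g -> nonneg_measurable h ->
  integral_on mu S (fun y => g y + h y) x = integral_on mu S g x + integral_on mu S h x.
Proof.
move=> gg gh; rewrite !integral_onE; elim: (enum S) x => //= v s IH x.
rewrite /integral_coord -ge0_integralD //.
- by apply: eq_integral => y _; exact: IH.
- by move=> y _; case: (nonneg_measurable_iterated s gg).
- exact/nonneg_measurable_slice/nonneg_measurable_iterated.
- by move=> y _; case: (nonneg_measurable_iterated s gh).
- exact/nonneg_measurable_slice/nonneg_measurable_iterated.
Qed.

Lemma le_integral_on S g h x : nonneg_measurable g -> nonneg_measurable h ->
  (forall y, g y <= h y) -> integral_on mu S g x <= integral_on mu S h x.
Proof.
move=> gg gh le_gh; rewrite !integral_onE; elim: (enum S) x => //= v s IH x.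
apply: ge0_le_integral => //.
- by move=> y _; case: (nonneg_measurable_iterated s gg).
- exact/nonneg_measurable_slice/nonneg_measurable_iterated.
- exact/nonneg_measurable_slice/nonneg_measurable_iterated.
Qed.

(** This transfers null sets without any bound of [h] by [g]. In each coordinate a nonnegative
    function has zero integral exactly when it vanishes almost everywhere, so inclusion of zero sets
    passes through every integration. *)
Lemma integral_on_eq0 S g h x : nonneg_measurable g -> nonneg_measurable h ->
  (forall y, g y = 0 -> h y = 0) ->
  integral_on mu S g x = 0 -> integral_on mu S h x = 0.
Proof.
move=> gg gh gh0; rewrite !integral_onE; elim: (enum S) x => [|v s IH] x /=.
  exact: gh0.
have H k y : nonneg_measurable k -> 0 <= iterated s k y.
  by move=> gk; case: (nonneg_measurable_iterated s gk).
rewrite /integral_coord => I0.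
have /(ae_eq_integral_abs (mu v) measurableT) N0 :
    measurable_fun setT (fun y : X v => iterated s g (eqtype.dfwith x y)).
  exact/nonneg_measurable_slice/nonneg_measurable_iterated.
have /(ae_eq_integral_abs (mu v) measurableT) M0 :
    measurable_fun setT (fun y : X v => iterated s h (eqtype.dfwith x y)).
  exact/nonneg_measurable_slice/nonneg_measurable_iterated.
have {}/N0 N0 : \int[mu v]_y `|iterated s g (eqtype.dfwith x y)| = 0.
  by rewrite -[RHS]I0; apply: eq_integral => y _; rewrite gee0_abs ?H.
transitivity (\int[mu v]_y `|iterated s h (eqtype.dfwith x y)|).
  by apply: eq_integral => y _; rewrite gee0_abs ?H.
by apply/M0; apply: filterS N0 => y /= /(_ I); rewrite /= => ? _; exact: IH.
Qed.

(** Tonelli for products: [p i] involves no variable integrated for another index, so one index at a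
    time can be split off. *)
Lemma integral_on_prod (I : finType) (P : {set I}) (S U : I -> {set V})
    (p : I -> config X -> \bar R) x :
  (forall i, i \in P -> nonneg_measurable (p i)) ->
  (forall i j, i \in P -> j \in P -> i != j -> [disjoint S i & S j]) ->
  (forall i, i \in P -> depends_on (U i) (p i)) ->
  (forall i j, i \in P -> j \in P -> i != j -> [disjoint U i & S j]) ->
  integral_on mu (\bigcup_(i in P) S i) (fun y => \prod_(i in P) p i y) x =
    \prod_(i in P) integral_on mu (S i) (p i) x.
Proof.
have [n] := ubnP #|P|; elim: n => // n IH in P x * => /ltnSE-nP gp dS dp dU.
have [->|[i iP]] := set_0Vmem P.
  by rewrite !big_set0 integral_on0 big_set0.
have PiP j : j \in P :\ i -> [/\ j \in P, i != j & j != i].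
  by rewrite !inE => /andP[ji ->]; split=> //; rewrite eq_sym.
have gP (Q : {set I}) : {subset Q <= P} ->
    nonneg_measurable (fun y => \prod_(j in Q) p j y).
  move=> QP; split; last first.
    by move=> y; apply: prode_ge0 => j /QP jP; case: (gp j jP).
  by apply: emeasurable_prod => j /QP /gp[].
have PiS : {subset P :\ i <= P} by move=> j /PiP[].
rewrite !(big_setD1 i iP) /= integral_on_setU; first last.
- rewrite finset.disjoints_subset; apply/fintype.subsetP => v vi; rewrite inE; apply/bigcupP.
  move=> -[j /PiP[jP ij _] vj].
  by have /pred0P/(_ v) := dS _ _ iP jP ij; rewrite /= vi vj.
- exact: gP.
rewrite (_ : (fun y => \prod_(j in P) p j y) =
    (fun y => p i y * \prod_(j in P :\ i) p j y)); last first.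
  by apply/funext => y; rewrite (big_setD1 i iP).
(* The factor [p i] is constant for the inner integration; the induction hypothesis evaluates the
   rest. *)
rewrite (_ : integral_on mu (\bigcup_(j in P :\ i) S j) _ =
    fun y => (\prod_(j in P :\ i) integral_on mu (S j) (p j) y) * p i y); last first.
  apply/funext => y; rewrite integral_onZl ?IH //.
  - by rewrite muleC.
  - by rewrite (leq_trans _ nP) // [X in (_ < X)%N](cardsD1 i) iP.
  - by move=> j /PiS; exact: gp.
  - by move=> j k /PiS jP /PiS; exact: dS.
  - by move=> j /PiS; exact: dp.
  - by move=> j k /PiS jP /PiS; exact: dU.
  - exact: gP.
  - by case: (gp i iP).
  - apply: depends_on_sub (dp i iP); apply/fintype.subsetP => v vi.
    rewrite inE; apply/bigcupP => -[j /PiP[jP ij _] vj].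
    by have /pred0P/(_ v) := dU _ _ iP jP ij; rewrite /= vi vj.
(* Now the integrals over the other [S j] are constant along [S i]. *)
rewrite [RHS]muleC; apply: (integral_onZl (S := S i) (g := p i)
  (c := fun y => \prod_(j in P :\ i) integral_on mu (S j) (p j) y)).
- exact: gp.
- move=> y; apply: prode_ge0 => j /PiS /gp gj.
  by case: (nonneg_measurable_integral_on (S j) gj).
- move=> y z yz; apply: eq_bigr => j /PiP[jP ij ji].
  apply: (depends_on_integral_on (S := S j) (dp j jP)) => v.
  rewrite !inE => /andP[_ vj]; apply: yz; rewrite inE; apply/negP => vi.
  by have /pred0P/(_ v) := dU _ _ jP iP ji; rewrite /= vi vj.
Qed.

End IteratedIntegral.

(** * Chain components under intervention *)

Section ChainComponents.
Variable V : finType.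
Implicit Types (E : {set hyperedge V}) (K H : dah V) (A S T tau : {set V}).

Lemma cohead_connect_sym E : connect_sym (cohead E).
Proof.
apply: sym_connect_sym => u v.
by apply/existsP/existsP => -[h /andP[hE /andP[uh vh]]]; exists h; rewrite hE uh vh.
Qed.

Lemma chain_components_equiv E :
  {in [set: V] & &, equivalence_rel (connect (cohead E))}.
Proof.
move=> u v w _ _ _; split=> [|uv]; first exact: connect0.
by rewrite (same_connect (cohead_connect_sym E) uv).
Qed.

Lemma chain_components_partition E :
  finset.partition (chain_components E) [set: V].
Proof. exact/equivalence_partitionP/chain_components_equiv. Qed.

Lemma mem_chain_component E tau u v : tau \in chain_components E -> u \in tau ->
  (v \in tau) = connect (cohead E) u v.
Proof.
move=> tauE utau; have /and3P[_ tI _] := chain_components_partition E.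
rewrite -(def_pblock tI tauE utau).
by rewrite pblock_equivalence_partition ?inE //; exact: chain_components_equiv.
Qed.

Lemma chain_component_of E v : exists2 tau, tau \in chain_components E & v \in tau.
Proof.
have /and3P[/eqP cE _ _] := chain_components_partition E.
have vE : v \in finset.cover (chain_components E) by rewrite cE inE.
by exists (finset.pblock (chain_components E) v); rewrite ?pblock_mem ?mem_pblock.
Qed.

Lemma chain_component_eq E tau tau' v :
  tau \in chain_components E -> tau' \in chain_components E ->
  v \in tau -> v \in tau' -> tau = tau'.
Proof.
move=> tE t'E vt vt'; have /and3P[_ tI _] := chain_components_partition E.
by rewrite -(def_pblock tI tE vt) -(def_pblock tI t'E vt').
Qed.

Lemma chain_component_neq0 E tau : tau \in chain_components E -> exists v, v \in tau.
Proof.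
move=> tE; apply/set0Pn; have /and3P[_ _] := chain_components_partition E.
by apply: contraNneq => <-.
Qed.

(** * Acyclicity and terminal components *)

Definition pd_step E : rel V := fun u v => cohead E u v || parent E u v.

Lemma connect_cohead_pd_step E u v : connect (cohead E) u v -> connect (pd_step E) u v.
Proof.
by apply: connect_sub => {u v} u v uv; apply: connect1; rewrite /pd_step uv.
Qed.

(** A path from [v] back to [u] would be closed by the parent step into a partially directed
    cycle. *)
Lemma parent_acyclic K u v : parent K u v -> ~~ connect (pd_step K) v u.
Proof.
move=> uv; apply/negP => /connectP[p vp up].
apply: (@hedges_acyclic V K (size p).+1 (fun i => nth v (v :: p) i)).
(* The last index is [size p]; its cyclic successor is [0], so the closing step goes from [u] to
   [v]. *)
have last_edge (i : 'I_(size p).+1) : ~~ (i < size p)%N ->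
    parent K (nth v (v :: p) i) (nth v (v :: p) (ordS i)).
  rewrite -leqNgt => pi.
  have -> : i = size p :> nat by apply/eqP; rewrite eqn_leq pi -ltnS ltn_ord.
  have -> : nat_of_ord (ordS i) = 0%N.
    have -> /= : nat_of_ord (ordS i) = (i.+1 %% (size p).+1)%N by [].
    have -> : i = size p :> nat by apply/eqP; rewrite eqn_leq pi -ltnS ltn_ord.
    by rewrite modnn.
  by rewrite nth_last /= -up.
split; last by exists ord_max; apply: last_edge; rewrite -leqNgt.
move=> i; have [ip|] := boolP (i < size p)%N; last by right; exact: last_edge.
have -> : nat_of_ord (ordS i) = i.+1.
  have -> /= : nat_of_ord (ordS i) = (i.+1 %% (size p).+1)%N by [].
  by rewrite modn_small.
by have /orP := pathP v vp i ip.
Qed.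

Lemma parent_notin K tau u v :
  tau \in chain_components K -> v \in tau -> parent K u v -> u \notin tau.
Proof.
move=> tK vt uv; rewrite (mem_chain_component u tK vt).
by apply: contra (parent_acyclic uv); exact: connect_cohead_pd_step.
Qed.

Lemma terminal_component K (D : {set {set V}}) :
  D \subset chain_components K -> D != finset.set0 ->
  exists2 tau, tau \in D & forall tau', tau' \in D -> [disjoint pa K tau' & tau].
Proof.
move=> /fintype.subsetP DK /set0Pn[tau0 D0].
(* A vertex reaching the fewest vertices lies in a terminal component. *)
have [v0 v0t] := chain_component_neq0 (DK _ D0).
have coverP v : reflect (exists2 tau, tau \in D & v \in tau) (v \in finset.cover D).
  exact: bigcupP.
have cv0 : v0 \in finset.cover D by apply/coverP; exists tau0.
pose reach v := #|[pred w | connect (pd_step K) v w]|.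
case: (@arg_minnP _ v0 (mem (finset.cover D)) reach cv0) => v /coverP[tau tD vt] vmin.
exists tau => // tau' t'D; apply/pred0P => u /=; apply/negP => /andP[].
rewrite /pa inE => /andP[ut' /bigcupP[w wt']]; rewrite inE => uw ut.
have /vmin : w \in finset.cover D by apply/coverP; exists tau'.
apply/negP; rewrite -ltnNge; apply: proper_card; apply/properP.
have vu : connect (pd_step K) v u.
  by apply: connect_cohead_pd_step; rewrite -(mem_chain_component u (DK _ tD) vt).
(* Everything reached from [w] is reached from [v] through [u]. The inclusion is strict: [v] reaches
   itself, but [w] cannot reach [v] by acyclicity. *)
split.
  apply/fintype.subsetP => z; rewrite !inE; apply: connect_trans.
  by apply: connect_trans vu (connect1 _); rewrite /pd_step uw orbT.
exists v; rewrite !inE ?connect0 //.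
by apply: contra (parent_acyclic uw) => wv; exact: connect_trans wv vu.
Qed.

(** An edge with empty head belongs to [comp_edges K tau] as soon as its tail lies in
    [tau :|: pa K tau], whereas intervention deletes it. *)
Definition headed E := forall h, h \in E -> hhead h != finset.set0.

Lemma htail_notin K tau h v : tau \in chain_components K -> h \in hedges K ->
  hhead h != finset.set0 -> hhead h \subset tau -> v \in htail h -> v \notin tau.
Proof.
move=> tK hK /set0Pn[w wh] /fintype.subsetP ht vh; apply: (parent_notin tK (ht _ wh)).
by apply/existsP; exists h; rewrite hK vh wh.
Qed.

(** A tail vertex is a parent of some head vertex in [tau] and lies outside [tau] by acyclicity,
    hence in [pa K tau]. *)
Lemma comp_edgesE K tau h : headed K -> tau \in chain_components K ->
  (h \in comp_edges K tau) = (h \in hedges K) && (hhead h \subset tau).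
Proof.
move=> hd tK; rewrite !inE; case hK: (h \in _) => //=.
case: (boolP (_ \subset tau)) => [ht|]; rewrite ?andbF // andbT.
apply/fintype.subsetP => v; rewrite !inE => /orP[vh|/(fintype.subsetP ht)-> //].
have vt := htail_notin tK hK (hd _ hK) ht vh; rewrite vt /=; apply/orP; right.
have [w wh] := set0Pn _ (hd _ hK).
apply/bigcupP; exists w; first exact: (fintype.subsetP ht).
by rewrite inE; apply/existsP; exists h; rewrite hK vh wh.
Qed.

(** Tails avoid [tau]. Potentials are indexed by vertex sets only, and this recovers the head from
    such a set. *)
Lemma vsetI_component K tau h : headed K -> tau \in chain_components K ->
  h \in hedges K -> hhead h \subset tau -> vset h :&: tau = hhead h.
Proof.
move=> hd tK hK ht; apply/setP => v; rewrite !inE.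
case: (boolP (v \in hhead h)) => vh; first by rewrite orbT (fintype.subsetP ht).
rewrite orbF; apply/negP => /andP[vt].
exact/negP/(htail_notin tK hK (hd _ hK) ht).
Qed.

Definition supports E tau : {set {set V}} := @vset V @: comp_edges E tau.

Lemma maximal_vsetsP E tau S :
  reflect (S \in supports E tau /\
    forall T, T \in supports E tau -> S \subset T -> T = S)
   (S \in maximal_vsets (comp_edges E tau)).
Proof. by rewrite inE; apply: maxsetP. Qed.

Lemma supports_sub E tau S : S \in supports E tau -> S \subset tau :|: pa E tau.
Proof. by case/imsetP => h; rewrite !inE => /andP[/andP[_ hs] _] ->. Qed.

(** * Components and maximal vertex sets after intervention *)

Section Intervention.
Variables (H : dah V) (A : {set V}).
Hypothesis headedH : headed H.
Let H' := intervene H A.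

Lemma headed_intervene : headed H'.
Proof. by move=> h; rewrite inE => /andP[]. Qed.

Lemma vset_intervene h : vset (intervene_edge A h) = vset h.
Proof.
apply/setP => v; rewrite !inE.
by case: (v \in h.1); case: (v \in h.2); case: (v \in A); rewrite ?orbT.
Qed.

Lemma component_intervene_sub tau' : tau' \in chain_components H' ->
  exists2 tau, tau \in chain_components H & tau' \subset tau.
Proof.
move=> tH'; have [v vt'] := chain_component_neq0 tH'.
have [tau tH vt] := chain_component_of H v.
exists tau => //; apply/fintype.subsetP => u.
rewrite (mem_chain_component u tH' vt') (mem_chain_component u tH vt).
apply: connect_sub => {u vt vt'} u w /cohead_intervene[uw _]; exact: connect1.
Qed.

Lemma component_intervene_subset tau tau' v :
  tau \in chain_components H -> tau' \in chain_components H' ->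
  v \in tau -> v \in tau' -> tau' \subset tau.
Proof.
move=> tH tH' vt vt'; have [tau0 t0H st] := component_intervene_sub tH'.
by rewrite (chain_component_eq tH t0H vt (fintype.subsetP st _ vt')).
Qed.

(** A surviving edge keeps a head vertex outside [A], and this vertex lies in [tau']. Conversely, a
    vertex of [S] in [tau' :\: A] is a head vertex of the edge; the heads that remain are co-heads
    of it, so they all lie in [tau']. *)
Lemma supports_intervene tau tau' S :
  tau \in chain_components H -> tau' \in chain_components H' -> tau' \subset tau ->
  (S \in supports H' tau') =
    (S \in supports H tau) && (S :&: (tau' :\: A) != finset.set0).
Proof.
move=> tH tH' /fintype.subsetP t't; apply/imsetP/andP => [[h]|[/imsetP[h]]].
  rewrite (comp_edgesE _ headed_intervene tH') => /andP[].
  rewrite inE => /andP[/imsetP[h0 h0H ->]]; rewrite hhead_intervene.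
  move=> /set0Pn[w]; rewrite inE => /andP[wA wh] /fintype.subsetP ht ->.
  have wt' : w \in tau' by apply: ht; rewrite inE wA wh.
  rewrite vset_intervene; split; last first.
    by apply/set0Pn; exists w; rewrite !inE wA wt' wh orbT.
  apply/imsetP; exists h0 => //; rewrite (comp_edgesE _ headedH tH) h0H /=.
  apply/fintype.subsetP => z zh; rewrite (mem_chain_component z tH (t't _ wt')).
  by apply: connect1; apply/existsP; exists h0; rewrite h0H wh zh.
rewrite (comp_edgesE _ headedH tH) => /andP[hH ht] ->.
move=> /set0Pn[w]; rewrite finset.in_setI finset.in_setD => /andP[wS /andP[wA wt']].
have wh : w \in hhead h.
  by rewrite -(vsetI_component headedH tH hH ht) inE wS (t't _ wt').
exists (intervene_edge A h); last by rewrite vset_intervene.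
have wh' : w \in hhead (intervene_edge A h) by rewrite hhead_intervene inE wA wh.
have hH' : intervene_edge A h \in intervene_edges A H.
  by rewrite inE imset_f //=; apply/set0Pn; exists w.
rewrite (comp_edgesE _ headed_intervene tH') [_ \in hedges _]hH' /=.
apply/fintype.subsetP => z zh; rewrite (mem_chain_component z tH' wt').
by apply: connect1; apply/existsP; exists (intervene_edge A h); rewrite hH' wh' zh.
Qed.

(** Meeting [tau' :\: A] is inherited by supersets, so maximality among the sets that meet it is
    maximality among all. *)
Lemma maximal_vsets_intervene tau tau' S :
  tau \in chain_components H -> tau' \in chain_components H' -> tau' \subset tau ->
  (S \in maximal_vsets (comp_edges H' tau')) =
    (S \in maximal_vsets (comp_edges H tau)) && (S :&: (tau' :\: A) != finset.set0).
Proof.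
move=> tH tH' t't; have sE T := supports_intervene T tH tH' t't.
apply/maximal_vsetsP/andP => [[]|[/maximal_vsetsP[SH Smax] meet]].
  rewrite sE => /andP[SH meet] Smax; split=> //; apply/maximal_vsetsP.
  split=> // T TH ST; apply: Smax => //; rewrite sE TH /=.
  by apply: contraNneq meet => T0; rewrite -finset.subset0 -T0; exact: finset.setSI.
split; first by rewrite sE SH meet.
by move=> T; rewrite sE => /andP[TH _]; exact: Smax.
Qed.

(** Vertices of [S] in [tau' :\: A] and in [tau'' :\: A] would both be heads of the intervened edge,
    hence in one component. *)
Lemma supports_intervene_disjoint tau tau' tau'' S :
  tau \in chain_components H -> tau' \in chain_components H' ->
  tau'' \in chain_components H' -> tau' \subset tau -> tau'' \subset tau ->
  tau' != tau'' -> S \in supports H' tau' -> [disjoint S & tau'' :\: A].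
Proof.
move=> tH t'H' t''H' t't t''t ne SH'.
have := SH'; rewrite (supports_intervene S tH t'H' t't) => /andP[/imsetP[h]].
rewrite (comp_edgesE _ headedH tH) => /andP[hH ht] SE /set0Pn[w].
rewrite !inE => /andP[wS /andP[wA wt']].
apply/pred0P => v /=; apply/negP; rewrite !inE => /andP[vS /andP[vA vt'']].
have headE z : z \in S -> z \in tau -> z \in hhead h.
  by rewrite -(vsetI_component headedH tH hH ht) inE SE => -> ->.
have wh := headE w wS (fintype.subsetP t't _ wt').
have vh := headE v vS (fintype.subsetP t''t _ vt'').
have vt' : v \in tau'.
  rewrite (mem_chain_component v t'H' wt'); apply: connect1.
  have hh z : z \in hhead h -> z \notin A -> z \in hhead (intervene_edge A h).
    by move=> zh zA; rewrite hhead_intervene inE zA.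
  apply/existsP; exists (intervene_edge A h); rewrite !hh // inE imset_f //=.
  by rewrite andbT; apply/set0Pn; exists w; exact: hh.
by rewrite (chain_component_eq t'H' t''H' vt' vt'') eqxx in ne.
Qed.

End Intervention.
End ChainComponents.

(** * Conditional factors *)

Section FineProduct.
Variable R : realType.
Local Open Scope ereal_scope.

(* Outside [fin_num], [fine] is [0]; it is still multiplicative on [[0, +oo]]. *)
Lemma fineM_ge0 (a b : \bar R) : 0 <= a -> 0 <= b -> fine (a * b) = (fine a * fine b)%R.
Proof.
have infty (c : \bar R) : 0 <= c -> fine (+oo * c) = 0%R.
  by rewrite le_eqVlt => /predU1P[<-|c0]; [rewrite mule0|rewrite gt0_mulye].
case: a b => [a| |] [b| |] // a0 b0; rewrite ?mul0r ?mulr0 ?infty //.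
by rewrite muleC infty //= mulr0.
Qed.

Lemma fine_prod_ge0 (I : finType) (P : pred I) (f : I -> \bar R) :
  (forall i, P i -> 0 <= f i) -> fine (\prod_(i | P i) f i) = (\prod_(i | P i) fine (f i))%R.
Proof.
move=> f0; pose Q (a : \bar R) (b : R) := 0 <= a /\ fine a = b.
suff [] : Q (\prod_(i | P i) f i) (\prod_(i | P i) fine (f i))%R by [].
apply: big_rec2 => [|i b a Pi [a0 <-]]; first by split.
by split; [rewrite mule_ge0 ?f0|rewrite fineM_ge0 ?f0].
Qed.

End FineProduct.

(** On nonnegative reals, [0] included, inversion is the power with exponent [-1]. *)
Lemma measurable_fun_invr dT (T : measurableType dT) (R : realType) (f : T -> R) :
  measurable_fun setT f -> (forall x, 0 <= f x) ->
  measurable_fun setT (fun x => (f x)^-1).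
Proof.
move=> mf f0; rewrite (_ : (fun _ => _) = (fun x => (f x) `^ (-1))); last first.
  by apply/funext => x; rewrite powR_inv1.
exact: (measurableT_comp (measurable_powR _) mf).
Qed.

Section ConditionalFactors.
Variables (V : finType) (d : V -> measure_display).
Variable X : forall v, measurableType (d v).
Variables (R : realType) (mu : forall v, {sigma_finite_measure set (X v) -> \bar R}).
Variable A : {set V}.
Implicit Types (K H : dah V) (S tau : {set V}) (psi : {set V} -> {set V} -> config X -> R).

Lemma nonneg_measurable_EFin (f : config X -> R) :
  measurable_fun setT f -> (forall x, 0 <= f x) -> nonneg_measurable (EFin \o f).
Proof. by move=> mf f0; split=> [|x]; [exact/measurable_EFinP|rewrite lee_fin]. Qed.

Definition potentials K psi := forall tau S, tau \in chain_components K ->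
  S \in maximal_vsets (comp_edges K tau) -> potential S (psi tau S).

Section OneComponent.
Variables (K : dah V) (psi : {set V} -> {set V} -> config X -> R) (tau : {set V}).
Hypotheses (pK : potentials K psi) (tauK : tau \in chain_components K).

Lemma psi_prod_ge0 x : 0 <= psi_prod K psi tau x.
Proof. by apply: prodr_ge0 => S /(pK tauK)[_ + _]. Qed.

Lemma measurable_psi_prod : measurable_fun setT (psi_prod K psi tau).
Proof.
rewrite (_ : psi_prod K psi tau =
    fun x => \prod_(S <- enum (maximal_vsets (comp_edges K tau))) psi tau S x).
  by apply: measurable_prod => S; rewrite mem_enum => /(pK tauK)[].
by apply/funext => x; rewrite big_enum.
Qed.

Lemma nonneg_measurable_psi_prod : nonneg_measurable (EFin \o psi_prod K psi tau).
Proof. exact: nonneg_measurable_EFin measurable_psi_prod psi_prod_ge0. Qed.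

Lemma depends_on_psi_prod (U : {set V}) :
  (forall S, S \in maximal_vsets (comp_edges K tau) -> S \subset U) ->
  depends_on U (psi_prod K psi tau).
Proof.
move=> MU x y xy; apply: eq_bigr => S SM.
by have [_ _] := pK tauK SM; apply; move=> v vS; apply: xy; exact: (fintype.subsetP (MU _ SM)).
Qed.

Lemma depends_on_psi_prod_pa : depends_on (tau :|: pa K tau) (psi_prod K psi tau).
Proof. by apply: depends_on_psi_prod => S /maximal_vsetsP[/supports_sub]. Qed.

Lemma nonneg_measurable_Znorm : nonneg_measurable (Znorm mu A K psi tau).
Proof. exact: nonneg_measurable_integral_on nonneg_measurable_psi_prod. Qed.

Lemma Znorm_ge0 x : (0 <= Znorm mu A K psi tau x)%E.
Proof. by case: nonneg_measurable_Znorm. Qed.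

Lemma fineZ_ge0 x : 0 <= fine (Znorm mu A K psi tau x).
Proof. exact: fine_ge0 (Znorm_ge0 x). Qed.

(** As [pa K tau] avoids [tau], this set is the union of [pa K tau] and [tau :&: A], the arguments
    of the normalizing constant. *)
Lemma depends_on_Znorm :
  depends_on ((tau :|: pa K tau) :\: (tau :\: A)) (Znorm mu A K psi tau).
Proof.
apply: depends_on_integral_on => x y xy.
by rewrite /= (depends_on_psi_prod_pa xy).
Qed.

Lemma cond_factor_ge0 x : 0 <= cond_factor mu A K psi tau x.
Proof. by rewrite mulr_ge0 ?psi_prod_ge0 // invr_ge0 fineZ_ge0. Qed.

Lemma measurable_invZ :
  measurable_fun setT (fun x => (fine (Znorm mu A K psi tau x))^-1).
Proof.
apply: measurable_fun_invr; last exact: fineZ_ge0.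
exact: (measurableT_comp (fine_measurable measurableT) nonneg_measurable_Znorm.1).
Qed.

Lemma measurable_cond_factor : measurable_fun setT (cond_factor mu A K psi tau).
Proof. exact: measurable_funM measurable_invZ measurable_psi_prod. Qed.

Lemma depends_on_cond_factor :
  depends_on (tau :|: pa K tau) (cond_factor mu A K psi tau).
Proof.
move=> x y xy; rewrite /cond_factor (depends_on_psi_prod_pa xy).
rewrite (depends_on_Znorm (y := y)) // => v.
by rewrite inE => /andP[_]; exact: xy.
Qed.

(** The normalizer comes out of the integral. The result is 1 when it is positive and finite, and 0
    when it is 0 or infinite, because both [fine +oo] and the inverse of 0 are 0. *)
Lemma integral_on_cond_factor x :
  (integral_on mu (tau :\: A) (EFin \o cond_factor mu A K psi tau) x <= 1)%E.
Proof.
pose c y : \bar R := ((fine (Znorm mu A K psi tau y))^-1)%:E.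
rewrite (_ : _ \o _ = fun y => (c y * (psi_prod K psi tau y)%:E)%E) //.
rewrite (integral_onZl mu (c := c) (g := EFin \o psi_prod K psi tau)).
- rewrite -/(Znorm mu A K psi tau x) /c.
  case: (Znorm mu A K psi tau x) (Znorm_ge0 x) => [z| |] //= z0; last first.
    by rewrite invr0 mul0e lee_fin.
  rewrite -EFinM lee_fin.
  by have [->|z'] := eqVneq z 0; rewrite ?mulr0 ?mulVf.
- exact: nonneg_measurable_psi_prod.
- by move=> y; rewrite lee_fin invr_ge0 fineZ_ge0.
- move=> y z yz; rewrite /c (depends_on_Znorm (y := z)) // => v.
  by rewrite !inE => /andP[vtA _]; apply: yz; rewrite !inE.
Qed.

End OneComponent.

Lemma nonneg_measurable_prod_cond_factor K psi (D : {set {set V}}) :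
  potentials K psi -> D \subset chain_components K ->
  nonneg_measurable (fun x => (\prod_(tau in D) cond_factor mu A K psi tau x)%:E).
Proof.
move=> pK /fintype.subsetP DK; apply: nonneg_measurable_EFin; last first.
  by move=> x; apply: prodr_ge0 => tau /DK tK; exact: cond_factor_ge0 pK tK x.
rewrite (_ : (fun _ => _) =
    fun x => \prod_(tau <- enum D) cond_factor mu A K psi tau x).
  by apply: measurable_prod => tau; rewrite mem_enum => /DK; exact: measurable_cond_factor pK.
by apply/funext => x; rewrite big_enum.
Qed.

Lemma integral_on_prod_cond_factor K psi (D : {set {set V}}) x :
  potentials K psi -> D \subset chain_components K ->
  (integral_on mu (finset.cover D :\: A)
    (fun y => (\prod_(tau in D) cond_factor mu A K psi tau y)%:E) x <= 1)%E.
Proof.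
move=> pK; have [n] := ubnP #|D|; elim: n => // n IH in D x * => /ltnSE-nD DK.
have [->|D0] := eqVneq D finset.set0.
  by rewrite /finset.cover big_set0 finset.set0D integral_on0 big_set0.
have [tau tD term] := terminal_component DK D0.
have tK := fintype.subsetP DK _ tD.
pose D' := D :\ tau.
have D'D : D' \subset D by exact: finset.subD1set.
have D'K : D' \subset chain_components K by exact: fintype.subset_trans D'D DK.
have gD' := nonneg_measurable_prod_cond_factor pK D'K.
have -> : finset.cover D :\: A = (finset.cover D' :\: A) :|: (tau :\: A).
  by rewrite -finset.setDUl /finset.cover (big_setD1 tau tD) /= finset.setUC.
rewrite integral_on_setU; first last.
- apply/pred0P => v /=; apply/negP; rewrite !inE => /andP[/andP[_ /bigcupP[t tD']] vt].
  case/andP => _ vtau; move: tD'; rewrite !inE => /andP[/eqP + tD0]; apply.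
  exact: chain_component_eq (fintype.subsetP DK _ tD0) tK vt vtau.
- exact: nonneg_measurable_prod_cond_factor.
apply: Order.POrderTheory.le_trans (IH D' x _ D'K); last first.
  by rewrite (leq_trans _ nD) // [X in (_ < X)%N](cardsD1 tau) tD.
have gt := nonneg_measurable_EFin (measurable_cond_factor pK tK) (cond_factor_ge0 pK tK).
apply: le_integral_on => //.
  exact/nonneg_measurable_integral_on/nonneg_measurable_prod_cond_factor.
move=> y; rewrite (_ : (fun _ => _) = fun z =>
    ((\prod_(t in D') cond_factor mu A K psi t z)%:E *
     (EFin \o cond_factor mu A K psi tau) z)%E); last first.
  by apply/funext => z; rewrite (big_setD1 tau tD) /= mulrC EFinM.
rewrite (integral_onZl mu (c := fun z => (\prod_(t in D') cond_factor mu A K psi t z)%:E)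
  (g := EFin \o cond_factor mu A K psi tau)) //.
- rewrite -[leRHS]mule1; apply: lee_wpmul2l; first by case: gD'.
  exact: integral_on_cond_factor.
- by case: gD'.
(* The factor of [t] involves only [t] and [pa K t]: the former misses [tau] because components are
   disjoint, the latter because [tau] is terminal. *)
- move=> z w zw; congr EFin; apply: eq_bigr => t; rewrite !inE => /andP[tne t0].
  apply: (depends_on_cond_factor pK (fintype.subsetP DK _ t0)) => v.
  rewrite inE => vt; apply: zw; rewrite !inE negb_and negbK; apply/orP; right.
  apply/negP => vtau; case/orP: vt => vt; last first.
    by have /pred0P/(_ v) := term t t0; rewrite /= vt vtau.
  move: tne; rewrite (chain_component_eq (fintype.subsetP DK _ t0) tK vt vtau).
  by rewrite eqxx.
Qed.

Lemma integral_on_factorization K psi x : potentials K psi ->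
  (integral_on mu (~: A) (fun y =>
    (\prod_(tau in chain_components K) cond_factor mu A K psi tau y)%:E) x <= 1)%E.
Proof.
move=> pK; have /and3P[/eqP cK _ _] := chain_components_partition K.
have := integral_on_prod_cond_factor x pK (fintype.subxx (chain_components K)).
by rewrite cK finset.setTD.
Qed.

(** * Comparison of the two products for matching potentials *)

Section Compare.
Variable H : dah V.
Hypothesis headedH : headed H.
Let H' := intervene H A.
Variables psi psi' : {set V} -> {set V} -> config X -> R.
Hypotheses (pH : potentials H psi) (pH' : potentials H' psi').
Hypothesis compat : forall tau tau' S,
  tau \in chain_components H -> tau' \in chain_components H' -> tau' \subset tau ->
  S \in maximal_vsets (comp_edges H' tau') -> psi tau S = psi' tau' S.

Definition subcomponents tau : {set {set V}} :=
  [set tau' in chain_components H' | tau' \subset tau].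

(** These are the potentials without any variable integrated in [Znorm]; no component of [H'] inside
    [tau] carries them. *)
Definition constant_part tau x : R :=
  \prod_(S in maximal_vsets (comp_edges H tau) | S :&: (tau :\: A) == finset.set0)
    psi tau S x.

Section Fixed.
Variable tau : {set V}.
Hypothesis tH : tau \in chain_components H.

Lemma subcomponentsP tau' :
  reflect (tau' \in chain_components H' /\ tau' \subset tau) (tau' \in subcomponents tau).
Proof. by rewrite inE; exact: andP. Qed.

Lemma subcomponent_of v : v \in tau -> exists2 tau', tau' \in subcomponents tau & v \in tau'.
Proof.
move=> vt; have [tau' t'H' vt'] := chain_component_of H' v.
exists tau' => //; apply/subcomponentsP; split=> //.
exact: component_intervene_subset tH t'H' vt vt'.
Qed.

Lemma psi_prod_split x : psi_prod H psi tau x =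
  constant_part tau x * \prod_(tau' in subcomponents tau) psi_prod H' psi' tau' x.
Proof.
rewrite /psi_prod (bigID (fun S => S :&: (tau :\: A) == finset.set0)) /=.
congr (_ * _); symmetry.
(* Each remaining maximal set belongs to exactly one subcomponent, so after the exchange every inner
   product has a single factor. *)
rewrite (exchange_big_dep (fun S =>
  (S \in maximal_vsets (comp_edges H tau)) && (S :&: (tau :\: A) != finset.set0))) /=.
  apply: eq_bigr => S /andP[SM /set0Pn[v]]; rewrite !inE => /andP[vS /andP[vA vt]].
  have [tau' t's vt'] := subcomponent_of vt.
  have [t'H' t't] := subcomponentsP _ t's.
  have SM' : S \in maximal_vsets (comp_edges H' tau').
    rewrite (maximal_vsets_intervene headedH S tH t'H' t't) SM /=.
    by apply/set0Pn; exists v; rewrite !inE vS vA.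
  rewrite (big_pred1 tau') => [|t]; first by rewrite (compat tH t'H' t't SM').
  apply/andP/eqP => [[/subcomponentsP[tH' tt] SMt]|->//].
  apply/eqP; apply: contraTT isT => ne; exfalso.
  have /maximal_vsetsP[St _] := SMt.
  have /pred0P/(_ v) := supports_intervene_disjoint headedH tH tH' t'H' tt t't ne St.
  by rewrite /= !inE vS vA vt'.
move=> tau' S /subcomponentsP[t'H' t't].
rewrite (maximal_vsets_intervene headedH S tH t'H' t't) => /andP[-> /set0Pn[v]] /=.
rewrite !inE => /andP[vS /andP[vA vt']]; apply/set0Pn; exists v.
by rewrite !inE vS vA (fintype.subsetP t't).
Qed.

Lemma constant_part_ge0 x : 0 <= constant_part tau x.
Proof. by apply: prodr_ge0 => S /andP[/(pH tH)[_ + _] _]. Qed.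

Lemma depends_on_constant_part : depends_on (~: (tau :\: A)) (constant_part tau).
Proof.
move=> x y xy; apply: eq_bigr => S /andP[/(pH tH)[_ _ dS] /eqP S0].
apply: dS => v vS; apply: xy; rewrite inE; apply/negP => vt.
by have := finset.in_set0 v; rewrite -S0 finset.in_setI vS vt.
Qed.

Lemma bigcup_subcomponents :
  \bigcup_(tau' in subcomponents tau) (tau' :\: A) = tau :\: A.
Proof.
apply/setP => v; rewrite [RHS]inE; apply/bigcupP/andP => [[t /subcomponentsP[_ tt]]|[vA vt]].
  by rewrite inE => /andP[-> /(fintype.subsetP tt)].
by have [t ts vt'] := subcomponent_of vt; exists t; rewrite // inE vA.
Qed.

Lemma Znorm_split x : Znorm mu A H psi tau x =
  ((constant_part tau x)%:E *
   \prod_(tau' in subcomponents tau) Znorm mu A H' psi' tau' x)%E.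
Proof.
(* Taking for [U] the union of the maximal sets makes the separation condition an instance of
   [supports_intervene_disjoint]. *)
rewrite /Znorm -(integral_on_prod mu (p := fun t => EFin \o psi_prod H' psi' t)
  (S := fun t => t :\: A)
  (U := fun t => \bigcup_(S in maximal_vsets (comp_edges H' t)) S)).
- rewrite bigcup_subcomponents -(integral_onZl mu
    (c := fun y => (constant_part tau y)%:E)
    (g := fun y => (\prod_(t in subcomponents tau) (psi_prod H' psi' t y)%:E)%E)).
  + congr integral_on; apply/funext => y /=.
    by rewrite psi_prod_split EFinM prodEFin.
  + split; last first.
      move=> y; apply: prode_ge0 => t /subcomponentsP[tH' _].
      by rewrite lee_fin psi_prod_ge0.
    apply: emeasurable_prod => t /subcomponentsP[tH' _].
    by case: (nonneg_measurable_psi_prod pH' tH').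
  + by move=> y; rewrite lee_fin constant_part_ge0.
  + by move=> y z yz; rewrite (depends_on_constant_part yz).
- by move=> t /subcomponentsP[tH' _]; exact: nonneg_measurable_psi_prod.
- move=> t u /subcomponentsP[tH' _] /subcomponentsP[uH' _] ne.
  apply/pred0P => v /=; apply/negP; rewrite !inE => /andP[/andP[_ vt] /andP[_ vu]].
  by rewrite (chain_component_eq tH' uH' vt vu) eqxx in ne.
- move=> t /subcomponentsP[tH' _] y z yz; congr EFin.
  apply: depends_on_psi_prod yz => // S SM; exact: finset.bigcup_sup.
- move=> t u /subcomponentsP[tH' tt] /subcomponentsP[uH' ut] ne.
  apply/pred0P => v /=; apply/negP => /andP[/bigcupP[S /maximal_vsetsP[St _] vS] vu].
  have /pred0P/(_ v) := supports_intervene_disjoint headedH tH tH' uH' tt ut ne St.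
  by rewrite /= vS vu.
Qed.

(** The constant part cancels against the normalizer unless it is 0, where the factor vanishes.
    Infinite or zero normalizers need no separate case: [fine] is multiplicative on nonnegative
    values and inversion is total. *)
Lemma cond_factor_split x : cond_factor mu A H psi tau x =
  (constant_part tau x != 0)%:R *
  \prod_(tau' in subcomponents tau) cond_factor mu A H' psi' tau' x.
Proof.
rewrite /cond_factor big_split /= psi_prod_split Znorm_split.
rewrite fineM_ge0 ?lee_fin ?constant_part_ge0 //; last first.
  by apply: prode_ge0 => t /subcomponentsP[tH' _]; exact: Znorm_ge0.
rewrite fine_prod_ge0; last by move=> t /subcomponentsP[tH' _]; exact: Znorm_ge0.
rewrite prodfV /=.
have [->|c0] := eqVneq; first by rewrite !mul0r mulr0.
by rewrite invfM mul1r mulrACA mulVf // mul1r.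
Qed.

End Fixed.

(** Each component of [H'] lies in exactly one component of [H]. *)
Lemma prod_subcomponents (F : {set V} -> R) :
  \prod_(tau in chain_components H) \prod_(tau' in subcomponents tau) F tau' =
  \prod_(tau' in chain_components H') F tau'.
Proof.
rewrite (exchange_big_dep (mem (chain_components H'))) /=; last first.
  by move=> tau tau' _ /subcomponentsP[].
apply: eq_bigr => tau' t'H'.
have [tau tH t't] := component_intervene_sub t'H'.
rewrite (big_pred1 tau) // => t; rewrite inE.
apply/andP/eqP => [[tH0 /andP[_ t't0]]|->]; last by rewrite tH t't andbT.
have [v vt'] := chain_component_neq0 t'H'.
exact: chain_component_eq tH0 tH (fintype.subsetP t't0 _ vt') (fintype.subsetP t't _ vt').
Qed.

Lemma factorization_split x :
  \prod_(tau in chain_components H) cond_factor mu A H psi tau x =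
  (\prod_(tau in chain_components H) (constant_part tau x != 0)%:R) *
  \prod_(tau' in chain_components H') cond_factor mu A H' psi' tau' x.
Proof.
rewrite -(prod_subcomponents (fun t => cond_factor mu A H' psi' t x)) -big_split /=.
by apply: eq_bigr => tau tH; exact: cond_factor_split.
Qed.

Lemma factorization_le x :
  \prod_(tau in chain_components H) cond_factor mu A H psi tau x <=
  \prod_(tau' in chain_components H') cond_factor mu A H' psi' tau' x.
Proof.
rewrite factorization_split; apply: ler_piMl.
  by apply: prodr_ge0 => t tH'; exact: cond_factor_ge0 pH' tH' x.
suff /andP[] : 0 <= \prod_(tau in chain_components H) ((constant_part tau x != 0)%:R : R) <= 1 by [].
apply: (big_ind (fun r : R => 0 <= r <= 1)) => [|a b /andP[a0 a1] /andP[b0 b1]|tau _].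
- by rewrite ler01 lexx.
- by rewrite mulr_ge0 // mulr_ile1.
- by rewrite ler0n lern1 leq_b1.
Qed.

End Compare.

(** Since [f = F] almost everywhere, [F] already has mass at least 1, while [F'] has mass at most 1;
    the nonnegative difference [F' - F] therefore has integral 0. *)
Lemma ae_on_of_le (S : {set V}) (f F F' : config X -> R) x :
  measurable_fun setT f -> (forall y, 0 <= f y) ->
  measurable_fun setT F -> (forall y, 0 <= F y) ->
  measurable_fun setT F' -> (forall y, F y <= F' y) ->
  (integral_on mu S (EFin \o f) x = 1)%E ->
  (integral_on mu S (EFin \o F') x <= 1)%E ->
  ae_on mu S x [set y | f y = F y]%classic ->
  ae_on mu S x [set y | f y = F' y]%classic.
Proof.
move=> mf f0 mF F0 mF' FF' If IF'.
have gf := nonneg_measurable_EFin mf f0; have gF := nonneg_measurable_EFin mF F0.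
pose D y : R := `|f y - F y|; pose D' y : R := F' y - F y.
have gD : nonneg_measurable (EFin \o D).
  apply: nonneg_measurable_EFin; last by move=> y; exact: normr_ge0.
  by apply: measurableT_comp => //; exact: measurable_funB.
have gD' : nonneg_measurable (EFin \o D').
  apply: nonneg_measurable_EFin; first exact: measurable_funB.
  by move=> y; rewrite subr_ge0.
pose N (G : config X -> R) (y : config X) : \bar R :=
  (\1_(~` [set y | f y = G y]%classic) y)%:E.
have gE (G : config X -> R) : measurable_fun setT G -> nonneg_measurable (N G).
  move=> mG; split=> [|y]; last by rewrite lee_fin indicE ler0n.
  apply/measurable_EFinP; apply: measurable_indic; apply: measurableC.
  rewrite (_ : mkset _ = ((fun y => f y - G y)%R @^-1` [set 0%R])%classic).
    rewrite -[X in measurable X]setTI.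
    by apply: measurable_funB => //; exact: measurable_set1.
  apply/seteqP; split=> y /=; first by move=> ->; rewrite subrr.
  by move/eqP; rewrite subr_eq0 => /eqP.
have indic_eq0 (G : config X -> R) y : N G y = 0%E <-> f y = G y.
  rewrite /N indicE; split=> [[/eqP]|fG].
    rewrite pnatr_eq0 eqb0 => /negP ny; apply: contrapT => fG; apply: ny.
    by rewrite inE.
  by rewrite memNset //=; apply.
have gDD (G1 G2 : config X -> \bar R) : nonneg_measurable G1 -> nonneg_measurable G2 ->
    nonneg_measurable (fun y => G1 y + G2 y)%E.
  move=> [mG1 G10] [mG2 G20]; split; first exact: emeasurable_funD.
  by move=> y; exact: adde_ge0.
rewrite /ae_on => N0.
(* [D] vanishes wherever the indicator of disagreement does. *)
have ID : integral_on mu S (EFin \o D) x = 0%E.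
  apply: (integral_on_eq0 (g := N F) (h := EFin \o D)) N0 => // [|y /indic_eq0 fF]; first exact: gE.
  by rewrite /= /D fF subrr normr0.
(* This follows from [f <= F + D]. *)
have IF : (1 <= integral_on mu S (EFin \o F) x)%E.
  rewrite -If -[leRHS]adde0 -ID -integral_onD //; apply: le_integral_on => //; first exact: gDD.
  move=> y; rewrite -EFinD lee_fin /D -lerBlDl; exact: ler_norm.
have ID' : integral_on mu S (EFin \o D') x = 0%E.
  have IDp : (0 <= integral_on mu S (EFin \o D') x)%E.
    by case: (nonneg_measurable_integral_on mu S gD').
  have : (integral_on mu S (EFin \o F) x + integral_on mu S (EFin \o D') x <= 1)%E.
    rewrite -integral_onD // (_ : (fun _ => _) = EFin \o F') //.
    by apply/funext => y; rewrite -EFinD /= /D' subrKC.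
  move=> le1; apply/eqP; rewrite eq_le IDp andbT.
  move: IF IDp le1; case: (integral_on mu S _ x) => [a| |] //;
    case: (integral_on mu S _ x) => [b| |] //.
  by rewrite -EFinD !lee_fin; lra.
change (integral_on mu S (N F') x = 0%E).
(* The sum [D + D'] vanishes only where [f = F = F']. *)
apply: (integral_on_eq0 (g := fun y => ((D y)%:E + (D' y)%:E)%E) (h := N F')).
- exact: (gDD (EFin \o D) (EFin \o D')).
- exact: gE.
- move=> y /eqP; rewrite -EFinD eqe paddr_eq0 ?normr_ge0 ?subr_ge0 //.
  rewrite normr_eq0 !subr_eq0 => /andP[/eqP fF /eqP F'F]; apply/indic_eq0.
  by rewrite fF F'F.
- by rewrite integral_onD // ID ID' adde0.
Qed.

End ConditionalFactors.

(** * Equivalence of the two factorizations *)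

Theorem theorem8 (R : realType) (V : finType) (d : V -> measure_display)
    (X : forall v, measurableType (d v))
    (mu : forall v, {sigma_finite_measure set (X v) -> \bar R})
    (H : dah V) (hH : forall h, h \in hedges H -> hhead h != finset.set0)
    (A : {set V}) (a0 : config X) :
  same_factorization mu A a0 H (intervene H A).
Proof.
move=> f [mf f0 If]; split=> -[fA [psi [pot fE]]]; split=> //.
(* Each component of the intervened hypergraph inherits the potentials of the component of [H]
   containing it; the default [finset.set0] is never reached on such components. *)
- pose comp (tau' : {set V}) : {set V} :=
    odflt finset.set0 [pick tau in chain_components H | tau' \subset tau].
  have compE tau tau' : tau \in chain_components H ->
      tau' \in chain_components (intervene H A) -> tau' \subset tau -> comp tau' = tau.
    move=> tH t'H' t't; rewrite /comp; case: pickP => [t /andP[tH0 tt]|/(_ tau)] /=.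
      have [v vt'] := chain_component_neq0 t'H'.
      exact: chain_component_eq tH0 tH (fintype.subsetP tt _ vt') (fintype.subsetP t't _ vt').
    by rewrite tH t't.
  pose psi' tau' := psi (comp tau').
  have compat tau tau' (S : {set V}) : tau \in chain_components H ->
      tau' \in chain_components (intervene H A) -> tau' \subset tau ->
      S \in maximal_vsets (comp_edges (intervene H A) tau') -> psi tau S = psi' tau' S.
    by move=> tH t'H' t't _; rewrite /psi' (compE tau).
  have pot' : potentials (intervene H A) psi'.
    move=> tau' S t'H'; have [tau tH t't] := component_intervene_sub t'H'.
    rewrite (maximal_vsets_intervene hH S tH t'H' t't) => /andP[SM _].
    by rewrite /psi' (compE tau) //; exact: pot.
  exists psi'; split=> //.
  have gK := nonneg_measurable_prod_cond_factor mu A _ (fintype.subxx _).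
  have mG K p : potentials K p -> measurable_fun setT (fun x : config X =>
      \prod_(tau in chain_components K) cond_factor mu A K p tau x).
    by move=> /gK[/measurable_EFinP].
  (* The two products may differ where some constant part vanishes; the unit mass of [f] makes the
     set of differences null. *)
  apply: ae_on_of_le mf f0 (mG H psi pot) _ (mG _ _ pot') _ If _ fE.
  + by move=> y; have [_ /(_ y)] := gK _ _ pot; rewrite lee_fin.
  + by move=> y; exact: factorization_le.
  + exact: integral_on_factorization.
(* A maximal set takes its potential from the one subcomponent it meets outside [A]. If it meets
   none, the value 1 makes the constant part equal to 1, so the two products agree everywhere. *)
- pose psi' (tau S : {set V}) : config X -> R :=
    if [pick tau' in chain_components (intervene H A) |
          (tau' \subset tau) && (S :&: (tau' :\: A) != finset.set0)] is Some tau'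
    then psi tau' S else cst 1.
  have pot' : potentials H psi'.
    move=> tau S tH SM; rewrite /psi'; case: pickP => [tau' /and3P[t'H' t't meet]|_].
      by apply: pot => //; rewrite (maximal_vsets_intervene hH S tH t'H' t't) SM.
    by split=> // x; exact: ler01.
  have compat tau tau' (S : {set V}) : tau \in chain_components H ->
      tau' \in chain_components (intervene H A) -> tau' \subset tau ->
      S \in maximal_vsets (comp_edges (intervene H A) tau') -> psi' tau S = psi tau' S.
    move=> tH t'H' t't SM'; have /maximal_vsetsP[St' _] := SM'.
    have := SM'; rewrite (maximal_vsets_intervene hH S tH t'H' t't) => /andP[_ meet].
    rewrite /psi'; case: pickP => [t /and3P[tH' tt meet_t]|/(_ tau')]; last first.
      by rewrite t'H' t't meet.
    (* The selected [t] must be [tau'], since [S] cannot meet two subcomponents outside [A]. *)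
    have [->//|ne] := eqVneq t tau'.
    have [v] := set0Pn _ meet_t; rewrite inE => /andP[vS vt].
    rewrite eq_sym in ne.
    have /pred0P/(_ v) := supports_intervene_disjoint hH tH t'H' tH' t't tt ne St'.
    by rewrite /= vS vt.
  exists psi'; split=> //.
  have FF' x : \prod_(tau in chain_components H) cond_factor mu A H psi' tau x =
      \prod_(tau in chain_components (intervene H A))
        cond_factor mu A (intervene H A) psi tau x.
    rewrite (factorization_split mu hH pot' pot compat) big1 ?mul1r // => tau _.
    rewrite (_ : constant_part _ _ _ _ _ = 1) ?oner_eq0 //.
    apply: big1 => S /andP[_ /eqP S0]; rewrite /psi'; case: pickP => // t.
    move=> /and3P[_ /fintype.subsetP tt /set0Pn[v]].
    rewrite !inE => /andP[vS /andP[vA vt]]; have := finset.in_set0 v.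
    by rewrite -S0 !inE vS vA tt.
  by rewrite (_ : mkset _ = [set x | f x = \prod_(tau in chain_components (intervene H A))
    cond_factor mu A (intervene H A) psi tau x]%classic) //; apply/seteqP;
    split=> x /= ->; rewrite FF'.
Qed.
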